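(* Let $a,b,c,\beta,\gamma$ be real constants with $a$ or $b$ a non-positive integer, and let $a_0(x)={}_2F_1(a,b;c;x)$ be the corresponding (polynomial) hypergeometric function. Consider planar quadratic systems $$\dot x=p_2(x),\qquad \dot y=y^2+(q_{11}x+q_{10})y+q_{22}x^2+q_{21}x+q_{20},\qquad (S)$$ where $p_2(x)=p_{22}x^2+p_{21}x+p_{20}$, for which the equation $p_2w''+rw'+\kappa w=0$, with $r(x)=(2p_{22}+q_{11}-2\beta)x+p_{21}+q_{10}-2\gamma$ and $\kappa$ constant, is the hypergeometric equation $$x(1-x)w''+\bigl(c-(a+b+1)x\bigr)w'-ab\,w=0$$ (i.e. $p_2=x(1-x)$, $r=c-(a+b+1)x$, $\kappa=-ab$). Then the most general such system which admits the invariant algebraic curve $$a_0\bigl(y-\bigl((\beta-q_{11})x+\gamma-q_{10}\bigr)\bigr)+p_2a_0'=0$$ with cofactor $y+\beta x+\gamma$ is $$\begin{aligned} \dot x={}&x(1-x),\\ \dot y={}&y^2+(2\beta-a-b+1)xy+(c-1+2\gamma)y+\gamma(\gamma+c-1)\\ &+\bigl(\beta^2+(2-a-b)\beta+(a-1)(b-1)\bigr)x^2\\ &+\bigl(c\beta-ab+(1-\gamma)(-2\beta-1+a+b)\bigr)x; \end{aligned}$$ that is, the curve is invariant with cofactor $y+\beta x+\gamma$ if and only if the system is this one.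
   Context: For a polynomial vector field associated with $\dot x=P(x,y)$, $\dot y=Q(x,y)$, of degree $m=\max\{\deg P,\deg Q\}$, and a polynomial $g(x,y)$, the curve $g=0$ is an invariant algebraic curve with cofactor $K$ if $P\,\partial g/\partial x+Q\,\partial g/\partial y=Kg$, where $K$ is a polynomial of degree at most $m-1$. Primes denote derivatives with respect to $x$. It is assumed that $c$ is not a non-positive integer, so that ${}_2F_1(a,b;c;x)$ is defined. *)

(* Defs.v *)
From mathcomp Require Import all_boot all_order all_algebra.
From mathcomp Require Import reals topology normedtype sequences.
(* The notations of mpoly clash with those of mathcomp-analysis. *)
From mathcomp Require Import -(notations) mpoly.

Set Implicit Arguments.
Unset Strict Implicit.
Unset Printing Implicit Defensive.

Import Order.TTheory GRing.Theory Num.Theory.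
Import numFieldNormedType.Exports.

Local Open Scope ring_scope.
Local Open Scope classical_set_scope.

Definition is_nonpos_int (R : realType) (a : R) : Prop :=
  exists n : nat, a = - n%:R.

Definition pochhammer (R : realType) (a : R) (n : nat) : R :=
  \prod_(i < n) (a + i%:R).

Definition hyp2F1_coef (R : realType) (a b c : R) (n : nat) : R :=
  pochhammer a n * pochhammer b n / (pochhammer c n * n`!%:R).

(* Only meaningful where the series converges and c is not a non-positive
   integer; when a or b is a non-positive integer the series terminates, so it
   converges for every t. *)
Definition hyp2F1 (R : realType) (a b c t : R) : R :=
  limn (series (fun n : nat => hyp2F1_coef a b c n * t ^+ n)).

Notation poly2 R := (mpoly 2 R) (only parsing).

Definition varx (R : realType) : poly2 R :=
  mpolyX R (mnm1 (ord0 : 'I_2)).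
Definition vary (R : realType) : poly2 R :=
  mpolyX R (mnm1 (ord_max : 'I_2)).
Definition dx (R : realType) (g : poly2 R) : poly2 R :=
  mderiv (ord0 : 'I_2) g.
Definition dy (R : realType) (g : poly2 R) : poly2 R :=
  mderiv (ord_max : 'I_2) g.

(* A univariate p, viewed as the bivariate polynomial p(x). *)
Definition in_x (R : realType) (p : {poly R}) : poly2 R :=
  horner_alg (varx R) p.

(* msize is the total degree plus one (and 0 for the zero polynomial), so the
   bound on K reads deg K <= max (deg P) (deg Q) - 1. *)
Definition invariant_curve (R : realType) (P Q g K : poly2 R) : Prop :=
  P * dx g + Q * dy g = K * g /\
  (msize K <= (maxn (msize P) (msize Q)).-1)%N.

Lemma pochhammer_eq0 (R : realType) (m n : nat) :
  (m < n)%N -> pochhammer (- m%:R : R) n = 0.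
Proof.
move=> lt_mn; apply/eqP/prodf_eq0; exists (Ordinal lt_mn) => //=.
by rewrite addNr.
Qed.

Lemma hyp2F1_polynomial (R : realType) (a b c : R) :
  is_nonpos_int a \/ is_nonpos_int b ->
  exists p : {poly R}, forall t, p.[t] = hyp2F1 a b c t.
Proof.
move=> hab.
have [m hm] : exists m : nat, forall n, (m < n)%N -> hyp2F1_coef a b c n = 0.
  by case: hab => -[m ->]; exists m => n lt_mn;
    rewrite /hyp2F1_coef (pochhammer_eq0 R lt_mn) ?mulr0 !mul0r.
exists (\poly_(i < m.+1) hyp2F1_coef a b c i) => t.
rewrite horner_poly /hyp2F1; apply/esym/cvg_lim => //.
apply: (@cvg_near_cst _ _ _ _ _ _ _).
exists m.+1 => // n /= le_mn; apply/esym.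
rewrite /series /= (big_cat_nat (leq0n m.+1)) //= big_mkord.
rewrite [X in _ + X]big1_seq ?addr0 // => i; rewrite mem_index_iota => /andP[_ /andP[hi _]].
by rewrite hm ?mul0r.
Qed.

(* Main.v *)
Require Import Defs.
From mathcomp Require Import all_boot all_order all_algebra.
From mathcomp Require Import ring lra.
From mathcomp Require Import reals topology normedtype sequences.
From mathcomp Require Import -(notations) mpoly.

(** Write s = (beta - q11) x + gamma - q10, so that the curve is
    g = a0 (y - s) + p2 a0'.  Expanding P dx g + Q dy g - K g with
    K = y + beta x + gamma in powers of y, the coefficients of y^2 and y cancel
    whatever a0 is, because s was chosen as the cofactor's x-part minus the
    coefficient of y in Q.  The remaining term is
      p2 (p2 a0'' + r a0' - s' a0) + a0 (Q(x,0) + (beta x + gamma) s),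
    in which the identification of r with c - (a + b + 1) x makes a
    hypergeometric operator appear.  Since a0 satisfies the hypergeometric
    equation, p2 a0'' + r a0' = a b a0, and everything becomes divisible by a0:
      P dx g + Q dy g - K g = a0 (Q - Qstar),
    where Qstar is the right-hand side of the announced system
    (invariance_defect).  As a0(0) = 1, the factor a0 is nonzero, and the
    bivariate polynomials form an integral domain, so g is invariant exactly
    when Q = Qstar.

    The differential equation comes from the recurrence between consecutive
    hypergeometric coefficients (hyp2F1_coefS), once the coefficients of the
    polynomial a0, known only through its values, are identified with them
    (coef_hyp2F1).  The degree condition on the cofactor holds in all cases,
    because P = x (1 - x) already has degree 2. *)

Set Implicit Arguments.
Unset Strict Implicit.
Unset Printing Implicit Defensive.

Import Order.TTheory GRing.Theory Num.Theory.
Import numFieldNormedType.Exports.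

Local Open Scope ring_scope.

(** * The hypergeometric polynomial and its differential equation *)

(** The difference would vanish at the infinitely many points 0, 1, 2, ... *)
Lemma poly_horner_inj (R : numDomainType) (p q : {poly R}) :
  (forall t, p.[t] = q.[t]) -> p = q.
Proof.
move=> pq; apply/eqP; rewrite -subr_eq0; apply/negPn/negP => nz.
set s := [seq i%:R : R | i <- iota 0 (size (p - q))].
have := max_poly_roots nz (rs := s).
rewrite size_map size_iota ltnn => /(_ _ _)/notF; apply.
  by apply/allP => _ /mapP[i _ ->]; rewrite /root !hornerE pq subrr.
by rewrite map_inj_uniq ?iota_uniq // => i j /eqP; rewrite eqr_nat => /eqP.
Qed.

Lemma hyp2F1_terminating (R : realType) (a b c t : R) (m : nat) :
  (forall n, (m < n)%N -> hyp2F1_coef a b c n = 0) ->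
  hyp2F1 a b c t = (\poly_(i < m.+1) hyp2F1_coef a b c i).[t].
Proof.
move=> hm; rewrite horner_poly; apply/cvg_lim => //.
apply: cvg_near_cst; exists m.+1 => // n /= le_mn.
rewrite /series /= (big_cat_nat (leq0n m.+1)) //= big_mkord.
rewrite [X in _ + X]big1_seq ?addr0 // => i.
by rewrite mem_index_iota => /andP[_ /andP[hi _]]; rewrite hm ?mul0r.
Qed.

Lemma hyp2F1_coef_eventually0 (R : realType) (a b c : R) :
  is_nonpos_int a \/ is_nonpos_int b ->
  exists m : nat, forall n, (m < n)%N -> hyp2F1_coef a b c n = 0.
Proof.
by case=> -[m ->]; exists m => n lt_mn;
  rewrite /hyp2F1_coef (pochhammer_eq0 R lt_mn) ?mulr0 !mul0r.
Qed.

Lemma coef_hyp2F1 (R : realType) (a b c : R) (p : {poly R}) :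
  is_nonpos_int a \/ is_nonpos_int b ->
  (forall t, p.[t] = hyp2F1 a b c t) ->
  forall n, p`_n = hyp2F1_coef a b c n.
Proof.
move=> /(hyp2F1_coef_eventually0 c)[m hm] hp n.
have -> : p = \poly_(i < m.+1) hyp2F1_coef a b c i.
  by apply: poly_horner_inj => t; rewrite hp (hyp2F1_terminating t hm).
by rewrite coef_poly; case: ltnP => // /hm ->.
Qed.

(** The hypothesis on c keeps every denominator c (c + 1) ... (c + n) nonzero;
    otherwise the quotients would be junk values and the recurrence could fail. *)
Lemma hyp2F1_coefS (R : realType) (a b c : R) (n : nat) :
  ~ is_nonpos_int c ->
  n.+1%:R * (c + n%:R) * hyp2F1_coef a b c n.+1 =
  (a + n%:R) * (b + n%:R) * hyp2F1_coef a b c n.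
Proof.
move=> hc.
have c_neq0 i : c + i%:R != 0.
  by apply/eqP => c0; apply: hc; exists i; apply/eqP; rewrite -addr_eq0 c0.
have pc_neq0 : pochhammer c n != 0 by apply/prodf_neq0 => i _.
have fn_neq0 : n`!%:R != 0 :> R by rewrite pnatr_eq0 -lt0n fact_gt0.
rewrite /hyp2F1_coef /pochhammer !big_ord_recr /= -!/(pochhammer _ _).
rewrite factS natrM; field.
by rewrite fn_neq0 pc_neq0 c_neq0 nat1r pnatr_eq0.
Qed.

(** In degree n, the equation is the recurrence hyp2F1_coefS: the coefficient
    of p_(n+1) is (n + 1) n + c (n + 1) and that of p_n is
    - n (n - 1) - (a + b + 1) n - a b = - (a + n) (b + n). *)
Lemma hyp2F1_ode (R : realType) (a b c : R) (p : {poly R}) :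
  ~ is_nonpos_int c -> (forall n, p`_n = hyp2F1_coef a b c n) ->
  'X * (1 - 'X) * p^`()^`() + (c%:P - (a + b + 1) *: 'X) * p^`()
  = (a * b) *: p.
Proof.
move=> hc hp; apply/polyP => n.
(* Each term becomes a shift by powers of X, whose coefficients are explicit. *)
have -> : 'X * (1 - 'X) * p^`()^`() + (c%:P - (a + b + 1) *: 'X) * p^`()
   = 'X * p^`()^`() - 'X * ('X * p^`()^`()) + c *: p^`()
     - (a + b + 1) *: ('X * p^`()).
  by rewrite -!mul_polyC; ring.
have := hyp2F1_coefS a b n hc.
have coef_derivE (q : {poly R}) i : q^`()`_i = i.+1%:R * q`_i.+1.
  by rewrite coef_deriv mulr_natl.
rewrite -!hp !(coefD, coefN, coefZ, coefXM) => e.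
(* Degrees 0 and 1 are apart since multiplying by X and X^2 shifts in zeros. *)
case: n e => [|[|n]] /= e; rewrite !coef_derivE; [lra | lra |].
rewrite -addn3 -addn2 -addn1 !natrD in e *; lra.
Qed.

(** * Univariate polynomials in the plane *)

Lemma mderivXU (n : nat) (R : nzRingType) (i j : 'I_n) :
  mderiv i (mpolyX R (mnm1 j)) = (j == i)%:R.
Proof.
rewrite mderivX mnm1E; case: eqVneq => [->|_]; last by rewrite scale0r.
by rewrite scale1r -[X in mnm_sub X _]add0m addmK mpolyX0.
Qed.

Lemma dx_in_x (R : realType) (p : {poly R}) : dx (in_x p) = in_x p^`().
Proof.
rewrite /dx /in_x; elim/poly_ind: p => [|p k ih].
  by rewrite deriv0 !rmorph0 mderiv0.
rewrite derivD derivM derivX derivC addr0 mulr1 !rmorphD !rmorphM /=.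
rewrite !horner_algX !horner_algC !alg_mpolyC mderivD mderivM mderivC addr0 ih.
by rewrite mderivXU eqxx mulr1.
Qed.

Lemma dy_in_x (R : realType) (p : {poly R}) : dy (in_x p) = 0.
Proof.
rewrite /dy /in_x; elim/poly_ind: p => [|p k ih].
  by rewrite !rmorph0 mderiv0.
rewrite !rmorphD !rmorphM /= horner_algX horner_algC alg_mpolyC.
by rewrite mderivD mderivM mderivC ih mderivXU mul0r mulr0 !addr0.
Qed.

(** A univariate polynomial is recovered from its values, which are the values
    of its image along the line x = t. *)
Lemma in_x_inj (R : realType) : injective (@in_x R).
Proof.
move=> p q pq; apply: poly_horner_inj => t.
have ev u : meval (fun=> t) (in_x u) = u.[t].
  rewrite /in_x; elim/poly_ind: u => [|u k ih]; first by rewrite !rmorph0 horner0.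
  rewrite !rmorphD !rmorphM /= horner_algX horner_algC alg_mpolyC.
  by rewrite mevalC mevalXU ih !hornerE.
by rewrite -!ev pq.
Qed.

(** * Degrees of the cofactor and of the system *)

Lemma msize_linear (R : realType) (u v : R) :
  (msize (vary R + u *: varx R + v%:A) <= 2)%N.
Proof.
rewrite (leq_trans (msizeD_le _ _)) // geq_max alg_mpolyC msizeC.
rewrite (leq_trans (leq_b1 _)) // andbT.
rewrite (leq_trans (msizeD_le _ _)) // geq_max msizeX mdeg1 /=.
by rewrite (leq_trans (msizeZ_le _ _)) // msizeX mdeg1.
Qed.

Lemma msize_logistic (R : realType) :
  (2 < msize (varx R * (1 - varx R) : poly2 R))%N.
Proof.
have /msize_mdeg_lt : mnm_muln (mnm1 ord0) 2 \in msupp (varx R * (1 - varx R)).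
  rewrite mcoeff_msupp mulrBr mulr1 -expr2 mcoeffB mcoeffXn eqxx mcoeffX.
  have /negPf -> : mnm1 ord0 != mnm_muln (mnm1 (ord0 : 'I_2)) 2.
    by apply/eqP => e; have := congr1 mdeg e; rewrite mdegMn mdeg1.
  by rewrite sub0r oppr_eq0 oner_eq0.
by rewrite mdegMn mdeg1.
Qed.

(** * The invariance condition *)

(** The computation behind the theorem: the failure of invariance, in which
    A, A1 and A2 stand for a0, a0' and a0''.  Treating them as independent
    elements of a commutative ring shows that the differential equation enters
    only through the last summand, where it is the vanishing factor. *)
Lemma invariance_defect (S : comNzRingType)
    (a b c beta gamma q22 q21 q20 x y A A1 A2 : S) :
  let p := x * (1 - x) in
  let q11 := 2 * beta - a - b + 1 in
  let q10 := c - 1 + 2 * gamma in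
  let s := (beta - q11) * x + (gamma - q10) in
  let Q := y ^+ 2 + (q11 * x + q10) * y + q22 * x ^+ 2 + q21 * x + q20 in
  let Qstar := y ^+ 2 + q11 * (x * y) + q10 * y + gamma * (gamma + c - 1)
    + (beta ^+ 2 + (2 - a - b) * beta + (a - 1) * (b - 1)) * x ^+ 2
    + (c * beta - a * b + (1 - gamma) * (- 2 * beta - 1 + a + b)) * x in
  p * (A1 * (y - s) - A * (beta - q11) + (1 - 2 * x) * A1 + p * A2) + Q * A
    - (y + beta * x + gamma) * (A * (y - s) + p * A1)
  = A * (Q - Qstar) + p * (p * A2 + (c - (a + b + 1) * x) * A1 - a * b * A).
Proof. by move=> p q11 q10 s Q Qstar; rewrite /Qstar /Q /s /p /q11 /q10; ring. Qed.

Theorem proposition5 (R : realType) (a b c beta gamma : R)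
  (hab : is_nonpos_int a \/ is_nonpos_int b)
  (hc : ~ is_nonpos_int c)
  (a0 : {poly R}) (ha0 : forall t : R, a0.[t] = hyp2F1 a b c t)
  (p22 p21 p20 q11 q10 q22 q21 q20 kappa : R) :
  let p2 : {poly R} := p22 *: 'X^2 + p21 *: 'X + p20%:P in
  let r : {poly R} :=
    (2 * p22 + q11 - 2 * beta) *: 'X + (p21 + q10 - 2 * gamma)%:P in
  let x : poly2 R := varx R in
  let y : poly2 R := vary R in
  let P : poly2 R := in_x p2 in
  let Q : poly2 R :=
    y ^+ 2 + (q11 *: x + q10%:A) * y + q22 *: x ^+ 2 + q21 *: x + q20%:A in
  let curve : poly2 R :=
    in_x a0 * (y - ((beta - q11) *: x + (gamma - q10)%:A)) + in_x (p2 * a0^`()) in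
  p2 = 'X * (1 - 'X) ->
  r = c%:P - (a + b + 1) *: 'X ->
  kappa = - (a * b) ->
  invariant_curve P Q curve (y + beta *: x + gamma%:A)
  <->
  P = x * (1 - x) /\
  Q = y ^+ 2 + (2 * beta - a - b + 1) *: (x * y) + (c - 1 + 2 * gamma) *: y
      + (gamma * (gamma + c - 1))%:A
      + (beta ^+ 2 + (2 - a - b) * beta + (a - 1) * (b - 1)) *: x ^+ 2
      + (c * beta - a * b + (1 - gamma) * (- 2 * beta - 1 + a + b)) *: x.
Proof.
move=> p2 r x y P Q curve hp hr _.
have ca0 := coef_hyp2F1 hab ha0.
(* The constant coefficient of a0 is 1. *)
have a0_neq0 : in_x a0 != 0.
  rewrite -[0](rmorph0 (horner_alg (varx R))) (inj_eq (@in_x_inj R)).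
  apply/eqP => /(congr1 (fun p : {poly R} => p`_0)); rewrite ca0 coef0.
  by rewrite /hyp2F1_coef /pochhammer !big_ord0 !mul1r invr1 => /eqP; rewrite oner_eq0.
have hP : P = x * (1 - x).
  by rewrite /P hp /in_x rmorphM rmorphB rmorph1 /= horner_algX.
have /(congr1 (fun p : {poly R} => (p`_1, p`_2))) := hp.
rewrite /p2 !(coefD, coefN, coefZ, coefXM, coefXn, coefC, coefX, coef1) /=.
case=> hp21 hp22.
have /(congr1 (fun p : {poly R} => (p`_0, p`_1))) := hr.
rewrite /r !(coefD, coefN, coefZ, coefC, coefX) /= => -[hr0 hr1].
have hq10 : q10 = c - 1 + 2 * gamma by lra.
have hq11 : q11 = 2 * beta - a - b + 1 by lra.
have ode : x * (1 - x) * in_x a0^`()^`()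
    + (mpolyC 2 c - (mpolyC 2 a + mpolyC 2 b + 1) * x) * in_x a0^`()
    = mpolyC 2 a * mpolyC 2 b * in_x a0.
  move: (congr1 (@in_x R) (hyp2F1_ode hc ca0)).
  rewrite -[_ *: a0]mul_polyC -[_ *: 'X]mul_polyC /in_x.
  rewrite !(rmorphD, rmorphM, rmorphN, rmorph1) /= !horner_algC !horner_algX.
  by rewrite !alg_mpolyC.
set Qstar := (X in _ <-> _ /\ _ = X).
have hcurve : curve =
    in_x a0 * (y - ((beta - q11) *: x + (gamma - q10)%:A))
    + x * (1 - x) * in_x a0^`().
  by rewrite /curve [in_x (_ * _)]rmorphM /= -/(in_x _) -hP.
have dcurve : dx curve =
    in_x a0^`() * (y - ((beta - q11) *: x + (gamma - q10)%:A))
    - in_x a0 * (beta - q11)%:A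
    + (1 - 2 * x) * in_x a0^`() + x * (1 - x) * in_x a0^`()^`().
  rewrite hcurve !alg_mpolyC -!mul_mpolyC.
  rewrite /dx !(mderivD, mderivN, mderivM, mderivC).
  rewrite -!/(dx (in_x _)) !dx_in_x !mderivXU /=.
  ring.
have dycurve : dy curve = in_x a0.
  rewrite hcurve !alg_mpolyC -!mul_mpolyC.
  rewrite /dy !(mderivD, mderivN, mderivM, mderivC).
  rewrite -!/(dy (in_x _)) !dy_in_x !mderivXU /=.
  ring.
have defect : P * dx curve + Q * dy curve - (y + beta *: x + gamma%:A) * curve
    = in_x a0 * (Q - Qstar).
  rewrite dcurve dycurve hP hcurve.
  have := invariance_defect (mpolyC 2 a) (mpolyC 2 b) (mpolyC 2 c)
    (mpolyC 2 beta) (mpolyC 2 gamma) (mpolyC 2 q22) (mpolyC 2 q21)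
    (mpolyC 2 q20) x y (in_x a0) (in_x a0^`()) (in_x a0^`()^`()).
  rewrite /= ode subrr mulr0 addr0 /Qstar /Q hq10 hq11.
  rewrite !alg_mpolyC -!mul_mpolyC.
  rewrite !expr2.
  by rewrite !(mpolyCD, mpolyCN, mpolyCM, mpolyC_nat, mpolyC1).
split=> [[/eqP inv _]|[_ eqQ]].
  split=> //; apply/eqP; rewrite -subr_eq0.
  by move: inv; rewrite -subr_eq0 defect mulf_eq0 (negPf a0_neq0).
split; first by apply/eqP; rewrite -subr_eq0 defect eqQ subrr mulr0.
apply: (leq_trans (msize_linear _ _)).
by rewrite -ltnS (ltn_predK (m := 2)) leq_max hP msize_logistic.
Qed.
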